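(* Let $F$ be a field of characteristic not $2$, let $\Gamma$ be an additive abelian group with a skew-symmetric bicharacter $\epsilon:\Gamma\times\Gamma\to F^*$, let $D\subset\mathrm{Der}^\epsilon(A)$ be a nonzero $\Gamma$-graded color-commutative subspace, where $A$ is a $\Gamma$-graded $(\epsilon,\Gamma)$-color-commutative associative $F$-algebra with an identity element, and suppose that $A$ is $\Gamma$-graded $D$-simple. Then $A[D]$ is a free left $A$-module with the homogeneous basis $\{d^\alpha\mid\alpha\in\mathcal J\}$.
   Context: A skew-symmetric bicharacter is a map $\epsilon:\Gamma\times\Gamma\to F^*$ with $\epsilon(\lambda,\mu)=\epsilon(\mu,\lambda)^{-1}$ and $\epsilon(\lambda,\mu+\nu)=\epsilon(\lambda,\mu)\epsilon(\lambda,\nu)$. For a nonzero homogeneous element $x$ of a $\Gamma$-graded space, $\bar x\in\Gamma$ denotes its degree (color), and $\epsilon(x,y):=\epsilon(\bar x,\bar y)$. $H(B)$ is the set of homogeneous elements of a graded space $B$. Put $\Gamma_\pm=\{\lambda\in\Gamma\mid\epsilon(\lambda,\lambda)=\pm1\}$; then $\Gamma=\Gamma_+\cup\Gamma_-$. $A=\bigoplus_{\lambda\in\Gamma}A_\lambda$ is $(\epsilon,\Gamma)$-color-commutative if $xy=\epsilon(x,y)yx$ for all $x,y\in H(A)$. A homogeneous color-derivation of degree $\bar\partial\in\Gamma$ is an $F$-linear map $\partial:A\to A$ with $\partial(a)\in A_{\bar\partial+\bar a}$ and $\partial(ab)=\partial(a)b+\epsilon(\partial,a)a\partial(b)$ for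 all $a,b\in H(A)$. $\mathrm{Der}^\epsilon_\lambda(A)$ is the space of homogeneous color-derivations of degree $\lambda$, and $\mathrm{Der}^\epsilon(A)=\bigoplus_{\lambda}\mathrm{Der}^\epsilon_\lambda(A)$. A graded subspace $D\subset\mathrm{Der}^\epsilon(A)$ is color-commutative if $\partial\partial'=\epsilon(\partial,\partial')\partial'\partial$ for all $\partial,\partial'\in H(D)$. $A$ is graded $D$-simple if it has no $\Gamma$-graded $D$-stable ideals other than $0$ and $A$. $A[D]$ is the associative subalgebra of $\mathrm{End}_F(A)$ generated by $A$ (acting by left multiplication) and $D$. $F_1=A^D=\{u\in A\mid\partial(u)=0\ \forall\,\partial\in D\}$; when $A$ is graded $D$-simple every nonzero homogeneous element of $F_1$ is invertible, so $F_1$ is a graded field. $F_1[D]$ is the subalgebra of $\mathrm{End}_F(A)$ generated by $F_1$ and $D$, and $\mathcal D=\mathrm{Der}^\epsilon(A)\cap F_1[D]$, which contains $D$. Fix a homogeneous $F_1$-basis $\{d_i\mid i\in\mathcal I\}$ of $\mathcal D$ and a total ordering on $\mathcal I$. $\mathcal J$ is the set of all families $\alpha=(\alpha_i)_{i\in\mathcal I}$ of nonnegative integers, all but finitely many equal to $0$, with $\alpha_i\le p-1$ for all $i$ if $\mathrm{char}\,F=p>0$, and with $\alpha_i\in\{0,1\}$ whenever $\bar d_i\in\Gamma_-$. For $\alpha\in\mathcal J$, $d^\alpha=\prod_{i\in\mathcal I}d_i^{\alpha_i}\in A[D]$, the product (composition) being taken in the fixed order of $\mathcal I$; $d^0=1$.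 *)

(* Defs.v *)
From HB Require Import structures.
From mathcomp Require Import all_boot all_order all_algebra finmap.
From mathcomp Require Import boolp classical_sets functions.

Set Implicit Arguments.
Unset Strict Implicit.
Unset Printing Implicit Defensive.

Import Order.TTheory GRing.Theory.
Local Open Scope classical_set_scope.
Local Open Scope ring_scope.

(* End_F(A) is represented inside the F-module A -> A of all functions, whose
   addition, zero and scaling are pointwise.  The associative product of
   End_F(A) is the composition \o, never the pointwise product of functions. *)

Definition bicharacter (F : fieldType) (Gamma : zmodType)
    (eps : Gamma -> Gamma -> F) : Prop :=
  [/\ forall l m, eps l m != 0,
      forall l m, eps l m = (eps m l)^-1
    & forall l m n, eps l (m + n) = eps l m * eps l n].

Definition Gamma_minus (F : fieldType) (Gamma : zmodType)
    (eps : Gamma -> Gamma -> F) : set Gamma :=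
  [set l | eps l l = -1].

Section GradedSpaces.
Variables (F : fieldType) (Gamma : zmodType) (V : lmodType F).

Definition subspace (W : set V) : Prop :=
  W 0 /\ forall (c : F) u v, W u -> W v -> W (c *: u + v).

Definition decomposition (V_ : Gamma -> set V) (v : V)
    (c : {fsfun Gamma -> V with 0}) : Prop :=
  (forall l, V_ l (c l)) /\ v = \sum_(l <- finsupp c) c l.

Definition sum_of (V_ : Gamma -> set V) : set V :=
  [set v | exists c, decomposition V_ v c].

Definition grading (V_ : Gamma -> set V) : Prop :=
  (forall l, subspace (V_ l)) /\ forall v, exists! c, decomposition V_ v c.

Definition graded_subspace (V_ : Gamma -> set V) (W : set V) : Prop :=
  subspace W /\ W `<=` sum_of (fun l => V_ l `&` W).

End GradedSpaces.

Section ColorAlgebras.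
Variables (F : fieldType) (Gamma : zmodType) (eps : Gamma -> Gamma -> F).
Variables (A : algType F) (A_ : Gamma -> set A).

Definition graded_algebra : Prop :=
  grading A_ /\
  forall l m a b, A_ l a -> A_ m b -> A_ (l + m) (a * b).

Definition color_commutative_algebra : Prop :=
  forall l m a b, A_ l a -> A_ m b -> a * b = eps l m *: (b * a).

Definition hom_endo (l : Gamma) : set (A -> A) :=
  [set f | linear f /\ forall m a, A_ m a -> A_ (l + m) (f a)].

Definition color_der_of (l : Gamma) : set (A -> A) :=
  [set f | hom_endo l f /\
     forall m n a b, A_ m a -> A_ n b ->
       f (a * b) = f a * b + eps l m *: (a * f b)].

Definition color_der : set (A -> A) := sum_of color_der_of.

Definition color_commutative_space (D : set (A -> A)) : Prop :=
  forall l m f g, (D `&` color_der_of l) f -> (D `&` color_der_of m) g ->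
    f \o g = eps l m *: (g \o f).

Definition ideal (I : set A) : Prop :=
  subspace I /\ forall a x, I x -> I (a * x) /\ I (x * a).

Definition stable_under (D : set (A -> A)) (I : set A) : Prop :=
  forall f x, D f -> I x -> I (f x).

Definition graded_D_simple (D : set (A -> A)) : Prop :=
  forall I : set A, graded_subspace A_ I -> ideal I -> stable_under D I ->
    I = [set 0] \/ I = [set: A].

Definition lmul (a : A) : A -> A := fun x => a * x.

Definition subalgebra (B : set (A -> A)) : Prop :=
  [/\ B `<=` [set f | linear f], subspace B, B id
    & forall f g, B f -> B g -> B (f \o g)].

(* U[D]: the subalgebra of End_F(A) generated by left multiplications by
   elements of U and by D. *)
Definition adjoin (U : set A) (D : set (A -> A)) : set (A -> A) :=
  smallest subalgebra (lmul @` U `|` D).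

Definition constants (D : set (A -> A)) : set A :=
  [set u | forall f, D f -> f u = 0].

Definition der_closure (D : set (A -> A)) : set (A -> A) :=
  color_der `&` adjoin (constants D) D.

Definition left_module (U : set A) (M : set (A -> A)) : Prop :=
  [/\ M 0, forall f g, M f -> M g -> M (f + g)
    & forall u f, U u -> M f -> M (lmul u \o f)].

Definition lin_comb (K : choiceType) (b : K -> A -> A)
    (c : {fsfun K -> A with 0}) : A -> A :=
  \sum_(k <- finsupp c) (lmul (c k) \o b k).

(* Finitely supported families of scalars in U, indexed by J. *)
Definition coefficients (U : set A) (K : choiceType) (J : set K)
    : set {fsfun K -> A with 0} :=
  [set c : {fsfun K -> A with 0} |
     (forall k, U (c k)) /\ forall k, k \in finsupp c -> J k].

(* The family (b k), k in J, is a basis of the left U-module M. *)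
Definition module_basis (U : set A) (M : set (A -> A))
    (K : choiceType) (J : set K) (b : K -> A -> A) : Prop :=
  [/\ forall k, J k -> M (b k),
      forall f, M f -> exists2 c, coefficients U J c & f = lin_comb b c
    & forall c : {fsfun K -> A with 0},
        coefficients U J c -> lin_comb b c = 0 -> forall k, c k = 0].

Section Monomials.
Variables (disp : Order.disp_t) (I : orderType disp).

Definition exponents (deg : I -> Gamma) : set {fsfun I -> nat with 0%N} :=
  [set alpha : {fsfun I -> nat with 0%N} |
     (forall p, p \in [pchar F] -> forall i, (alpha i <= p.-1)%N) /\
     (forall i, Gamma_minus eps (deg i) -> (alpha i <= 1)%N)].

Definition monomial (d : I -> A -> A) (alpha : {fsfun I -> nat with 0%N})
    : A -> A :=
  \big[@comp A A A/id]_(i <- sort <=%O (finsupp alpha)) iter (alpha i) (d i).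

End Monomials.
End ColorAlgebras.

(* Main.v *)
Require Import Defs.
From HB Require Import structures.
From mathcomp Require Import all_boot all_order all_algebra finmap.
From mathcomp Require Import boolp classical_sets functions.

Set Implicit Arguments.
Unset Strict Implicit.
Unset Printing Implicit Defensive.

Import Order.TTheory GRing.Theory.
Local Open Scope classical_set_scope.
Local Open Scope ring_scope.

(** Why [A[D]] is free over [A] on the ordered monomials.

    Write [F1] for the constants of [D].  Elements of [F1] color-commute with
    [D], so the algebra [F1[D]] is color-commutative, and so is the span over
    [F1] of the derivations [d i].  Twisting by the bicharacter turns color
    commutation into an ordinary closure property ([color_centralizer]), which
    is how [adjoin_commute_hom] obtains this for non-homogeneous elements too.

    Spanning.  A word in the letters [i] stands for the composition of the
    corresponding [d i].  The Leibniz rule moves scalars of [A] to the left,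
    color commutation sorts a word up to a scalar, [d i \o d i] vanishes when
    [d i] is odd, and in characteristic [p] the power [d i ^ p] of an even
    [d i] is again a color derivation in [F1[D]], hence a combination of the
    letters.  Each relation shortens the word or sorts it, so the sorted words
    with bounded multiplicities span ([straighten]).

    Independence.  Graded [D]-simplicity upgrades the [F1]-independence of the
    letters to [A]-independence ([free_over_algebra]): the values that one
    coefficient takes in the [A]-relations form a graded [D]-stable ideal, so
    a nontrivial relation can be normalized to have a coefficient 1; applying
    [D] to its coefficients kills that one, so in a shortest relation all
    coefficients are constants, which [F1]-independence excludes.  For words one argues by induction on the
    length ([wmap_free]).  The commutator of a word [s] with the multiplication
    by a homogeneous [x] is, up to words shorter by two, the sum over the
    letters [j] of [s] of a scalar times [d j x] times [s] with one [j] deleted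
    ([remainder_shorter]).  The scalar is a unit times the multiplicity of [j]
    when [j] is even and a unit when [j] is odd, and the bounds on
    multiplicities are exactly what makes it nonzero ([kappa_neq0]).
    Commuting a relation with [x] therefore yields a shorter relation,
    whose leading coefficients vanish by induction; letting [x] vary, this says
    that the top coefficients of the original relation are coefficients of an
    [A]-relation between the letters, so they vanish.

    Finally, exponent families and sorted words are two encodings of the same
    monomials. *)

(** * Linear maps given as plain functions *)

Section LinearMaps.
Variables (F : fieldType) (U V : lmodType F) (f : U -> V).
Hypothesis f_lin : linear f.

Lemma lin_add u v : f (u + v) = f u + f v.
Proof. by rewrite -[u]scale1r f_lin !scale1r. Qed.

Lemma lin_zero : f 0 = 0.
Proof. by apply: (addIr (f 0)); rewrite -lin_add !add0r. Qed.

Lemma lin_scale c u : f (c *: u) = c *: f u.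
Proof. by rewrite -[c *: u]addr0 f_lin lin_zero addr0. Qed.

Lemma lin_opp u : f (- u) = - f u.
Proof. by rewrite -scaleN1r lin_scale scaleN1r. Qed.

Lemma lin_sum (K : Type) (r : seq K) (h : K -> U) :
  f (\sum_(k <- r) h k) = \sum_(k <- r) f (h k).
Proof.
elim: r => [|k r IHr]; first by rewrite !big_nil lin_zero.
by rewrite !big_cons lin_add IHr.
Qed.
End LinearMaps.

Section LinearCalculus.
Variables (F : fieldType).

Lemma comp_linear (U V W : lmodType F) (f : V -> W) (g : U -> V) :
  linear f -> linear g -> linear (fun x => f (g x)).
Proof. by move=> fL gL c u v; rewrite gL fL. Qed.

Lemma scale_linear (U V : lmodType F) (f : U -> V) (k : F) :
  linear f -> linear (fun x => k *: f x).
Proof. by move=> fL c u v; rewrite fL scalerDr !scalerA mulrC. Qed.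

Lemma add_linear (U V : lmodType F) (f g : U -> V) :
  linear f -> linear g -> linear (fun x => f x + g x).
Proof. by move=> fL gL c u v; rewrite fL gL scalerDr addrACA. Qed.

Lemma zero_linear (U V : lmodType F) : linear (fun _ : U => 0 : V).
Proof. by move=> c u v; rewrite scaler0 addr0. Qed.

Lemma sum_linear (K : Type) (r : seq K) (U V : lmodType F) (h : K -> U -> V) :
  (forall k, linear (h k)) -> linear (fun x => \sum_(k <- r) h k x).
Proof.
move=> hL c u v; rewrite scaler_sumr -big_split.
by apply: eq_bigr => k _; rewrite hL.
Qed.
End LinearCalculus.

Section Subspaces.
Variables (F : fieldType) (V : lmodType F) (W : set V).
Hypothesis W_sub : subspace W.

Lemma subspace_zero : W 0. Proof. by case: W_sub. Qed.

Lemma subspace_scale c v : W v -> W (c *: v).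
Proof. by case: W_sub => W0 Wl Wv; rewrite -[_ *: _]addr0; apply: Wl. Qed.

Lemma subspace_add u v : W u -> W v -> W (u + v).
Proof. by case: W_sub => _ Wl Wu Wv; rewrite -[u]scale1r; apply: Wl. Qed.

Lemma subspace_sum (K : eqType) (r : seq K) (h : K -> V) :
  (forall k, k \in r -> W (h k)) -> W (\sum_(k <- r) h k).
Proof.
move=> Wh; rewrite big_seq; elim/big_ind: _ => //.
- exact: subspace_zero.
- exact: subspace_add.
Qed.

Lemma subspace_sum_of (Gamma : zmodType) (V_ : Gamma -> set V) :
  (forall l, V_ l `<=` W) -> sum_of V_ `<=` W.
Proof. by move=> VW _ [c [cV ->]]; apply: subspace_sum => l _; apply: VW. Qed.
End Subspaces.

(** * Left spans and independence in the functions from A to A *)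

Section LinearCombinations.
Variables (F : fieldType) (A : algType F) (K : choiceType) (f : K -> A -> A).

Lemma lin_combE (c : {fsfun K -> A with 0}) x :
  lin_comb f c x = \sum_(k <- finsupp c) c k * f k x.
Proof. by rewrite /lin_comb fct_sumE. Qed.

(** The independence and spanning arguments are run on duplicate-free lists of
    indices; this converts such data to a finitely supported family. *)
Definition seq_coef (r : seq K) (a : K -> A) : {fsfun K -> A with 0} :=
  [fsfun k in [fset k in r]%fset => a k].

Lemma seq_coefE r a k : seq_coef r a k = if k \in r then a k else 0.
Proof. by rewrite fsfunE in_fset. Qed.

Lemma lin_comb_seq r a x : uniq r ->
  lin_comb f (seq_coef r a) x = \sum_(k <- r) a k * f k x.
Proof.
move=> r_uniq; rewrite lin_combE [RHS](bigID (fun k => a k != 0)) /=.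
rewrite [X in _ + X]big1 ?addr0 => [|k /negPn/eqP->]; last by rewrite mul0r.
rewrite -[RHS]big_filter (perm_big [seq k <- r | a k != 0]) /=.
  rewrite big_seq [RHS]big_seq; apply: eq_bigr => k.
  by rewrite mem_filter seq_coefE => /andP[_ ->].
apply: uniq_perm; rewrite ?fset_uniq ?filter_uniq // => k.
by rewrite mem_filter mem_finsupp seq_coefE; case: ifP; rewrite ?eqxx ?andbF ?andbT.
Qed.
End LinearCombinations.

Section Spans.
Variables (F : fieldType) (A : algType F) (K : eqType) (b : K -> A -> A).
Implicit Types (P : set K) (f g : A -> A).

(** The left [A]-submodule generated by the [b k]; being a smallest submodule,
    it is explored by [lspan_ind], and unfolded to finite sums only by
    [lspan_list]. *)
Definition lspan P : set (A -> A) := smallest (left_module [set: A]) (b @` P).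

Lemma lspan_gen P k : P k -> lspan P (b k).
Proof. by move=> Pk; apply: sub_gen_smallest; exists k. Qed.

Lemma lspan_ind P (M : set (A -> A)) : left_module [set: A] M ->
  (forall k, P k -> M (b k)) -> lspan P `<=` M.
Proof. by move=> M_mod bM; apply: smallest_sub => // _ [k Pk <-]; apply: bM. Qed.

Lemma lspan_zero P : lspan P (fun=> 0).
Proof. by move=> M [[M0 _ _] _]. Qed.

Lemma lspan_add P f g : lspan P f -> lspan P g -> lspan P (fun x => f x + g x).
Proof. by move=> Pf Pg M MP; case: (MP.1) => _ + _; apply; [apply: Pf|apply: Pg]. Qed.

Lemma lspan_mull P a f : lspan P f -> lspan P (fun x => a * f x).
Proof. by move=> Pf M MP; case: (MP.1) => _ _; apply => //; apply: Pf. Qed.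

Lemma lspan_module P : left_module [set: A] (lspan P).
Proof.
split=> [|f g|a f _]; [exact: lspan_zero | exact: lspan_add | exact: lspan_mull].
Qed.

Lemma lspan_scale P c f : lspan P f -> lspan P (fun x => c *: f x).
Proof.
move=> /(lspan_mull (c *: 1)); congr lspan; apply/funext => x.
by rewrite mulr_algl.
Qed.

Lemma lspan_sum P (L : eqType) (r : seq L) (h : L -> A -> A) :
  (forall k, k \in r -> lspan P (h k)) -> lspan P (fun x => \sum_(k <- r) h k x).
Proof.
elim: r => [|k r IHr] hP.
  rewrite [X in lspan P X](_ : _ = fun=> 0); first exact: lspan_zero.
  by apply/funext => x; rewrite big_nil.
rewrite [X in lspan P X](_ : _ = fun x => h k x + \sum_(k <- r) h k x).
  apply: lspan_add; first by apply: hP; rewrite mem_head.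
  by apply: IHr => i ir; apply: hP; rewrite inE ir orbT.
by apply/funext => x; rewrite big_cons.
Qed.

Lemma lspan_trans P P' : (forall k, P k -> lspan P' (b k)) -> lspan P `<=` lspan P'.
Proof. by apply: lspan_ind; apply: lspan_module. Qed.

Lemma lspan_sub P P' : P `<=` P' -> lspan P `<=` lspan P'.
Proof. by move=> PP'; apply: lspan_trans => k /PP'; apply: lspan_gen. Qed.

Lemma lspan_list P f : lspan P f -> exists Q : seq (A * K),
  (forall q, q \in Q -> P q.2) /\ forall x, f x = \sum_(q <- Q) q.1 * b q.2 x.
Proof.
move: f; apply: lspan_ind => [|k Pk]; last first.
  exists [:: (1, k)]; split=> [q|x]; first by rewrite inE => /eqP->.
  by rewrite big_seq1 mul1r.
split=> [|f g [Q [QP fE]] [Q' [QP' gE]]|a f _ [Q [QP fE]]].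
- by exists [::]; split=> // x; rewrite big_nil.
- exists (Q ++ Q'); split=> [q|x]; last by rewrite big_cat /= -fE -gE.
  by rewrite mem_cat => /orP[/QP|/QP'].
- exists [seq (a * q.1, q.2) | q <- Q]; split=> [_ /mapP[q /QP Pq ->] //|x].
  by rewrite /lmul /= fE big_map mulr_sumr; apply: eq_bigr => q _; rewrite mulrA.
Qed.

Lemma collect_terms (Q : seq (A * K)) x :
  \sum_(k <- undup [seq q.2 | q <- Q]) (\sum_(q <- Q | q.2 == k) q.1) * b k x =
  \sum_(q <- Q) q.1 * b q.2 x.
Proof.
under eq_bigr do rewrite mulr_suml.
rewrite (exchange_big_dep predT) //= [LHS]big_seq [RHS]big_seq.
apply: eq_bigr => q qQ; rewrite (eq_bigl (pred1 q.2)) => [|i]; last by rewrite /= eq_sym.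
by rewrite -big_filter filter_pred1_uniq ?undup_uniq ?mem_undup ?map_f // big_seq1.
Qed.

Definition lfree P : Prop :=
  forall (r : seq K) (a : K -> A), uniq r -> (forall k, k \in r -> P k) ->
    (forall x, \sum_(k <- r) a k * b k x = 0) -> forall k, k \in r -> a k = 0.

(** Independence for sums in which an index may be repeated. *)
Lemma lfree_collect P (Q : seq (A * K)) : lfree P ->
    (forall q, q \in Q -> P q.2) -> (forall x, \sum_(q <- Q) q.1 * b q.2 x = 0) ->
  forall k, \sum_(q <- Q | q.2 == k) q.1 = 0.
Proof.
move=> Pfree QP Q0 k; set r := undup [seq q.2 | q <- Q].
have [kr|kr] := boolP (k \in r); last first.
  rewrite big_seq_cond big1 // => q /andP[qQ /eqP qk]; case/negP: kr.
  by rewrite mem_undup -qk map_f.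
apply: (Pfree r (fun k => \sum_(q <- Q | q.2 == k) q.1)); rewrite ?undup_uniq //.
  by move=> {k kr} k; rewrite mem_undup => /mapP[q /QP Pq ->].
by move=> x; rewrite collect_terms.
Qed.
End Spans.

Section SpansAndLinearCombinations.
Variables (F : fieldType) (A : algType F) (K : choiceType) (b : K -> A -> A).
Variable P : set K.

Lemma lin_comb_lspan c : coefficients [set: A] P c -> lspan b P (lin_comb b c).
Proof.
move=> [_ cP]; have -> : lin_comb b c = fun x => \sum_(k <- finsupp c) c k * b k x.
  by apply/funext => x; rewrite lin_combE.
by apply: lspan_sum => k kc; apply: lspan_mull; apply: lspan_gen; apply: cP.
Qed.

Lemma lspan_lin_comb f : lspan b P f ->
  exists2 c, coefficients [set: A] P c & f = lin_comb b c.
Proof.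
move=> /lspan_list[Q [QP fE]].
exists (seq_coef (undup [seq q.2 | q <- Q]) (fun k => \sum_(q <- Q | q.2 == k) q.1)).
  split=> // k; rewrite mem_finsupp seq_coefE; case: ifP => [|_]; last by rewrite eqxx.
  by rewrite mem_undup => /mapP[q /QP Pq ->].
by apply/funext => x; rewrite lin_comb_seq ?undup_uniq // collect_terms.
Qed.

Lemma lfree_lin_comb c : lfree b P -> coefficients [set: A] P c ->
  lin_comb b c = 0 -> forall k, c k = 0.
Proof.
move=> Pfree [_ cP] c0 k; have [kc|] := boolP (k \in finsupp c); last exact: fsfun_dflt.
apply: (Pfree (finsupp c) c) => // x.
by rewrite -lin_combE c0.
Qed.
End SpansAndLinearCombinations.

(** * Homogeneous components *)

Section Components.
Variables (F : fieldType) (Gamma : zmodType) (V : lmodType F).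
Variable V_ : Gamma -> set V.

(** The decomposition is picked by choice so that it needs no proof argument;
    it is meaningful as soon as [V_] is a grading ([hdecP]). *)
Definition hdec (v : V) : {fsfun Gamma -> V with 0} :=
  xget [fsfun] [set c | decomposition V_ v c].

Definition hcomp (l : Gamma) (v : V) : V := hdec v l.

(** The diagonal map acting by [chi m] in degree [m].  For [chi := eps l] it
    carries the signs of the color calculus, so that statements about
    homogeneous elements extend to all elements by linearity. *)
Definition twist (chi : Gamma -> F) (v : V) : V :=
  \sum_(m <- finsupp (hdec v)) chi m *: hcomp m v.

Hypothesis gr : grading V_.

Lemma hdecP v : decomposition V_ v (hdec v).
Proof.
case: gr => _ /(_ v) [c [cP _]].
by rewrite /hdec; case: xgetP => [c' -> // | /(_ c)].
Qed.

Lemma hcomp_mem l v : V_ l (hcomp l v).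
Proof. by case: (hdecP v). Qed.

Lemma hcomp_supp l v : l \notin finsupp (hdec v) -> hcomp l v = 0.
Proof. exact: fsfun_dflt. Qed.

Lemma sum_hcomp v : v = \sum_(l <- finsupp (hdec v)) hcomp l v.
Proof. by case: (hdecP v). Qed.

Lemma sum_hcomp_sub (S : {fset Gamma}) v :
  (finsupp (hdec v) `<=` S)%fset -> v = \sum_(l <- S) hcomp l v.
Proof.
move=> sub; rewrite {1}(sum_hcomp v); apply: big_fset_incl => // l _.
exact: hcomp_supp.
Qed.

(** Uniqueness of decompositions, in the form used to compute components: any
    finite homogeneous expansion of [v] lists its components. *)
Lemma hcomp_uniq (S : {fset Gamma}) (g : Gamma -> V) v :
    (forall l, V_ l (g l)) -> (forall l, l \notin S -> g l = 0) ->
    v = \sum_(l <- S) g l ->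
  forall l, hcomp l v = g l.
Proof.
move=> gV g0 vE l.
pose c : {fsfun Gamma -> V with 0} := [fsfun m in S => g m].
have cE m : c m = g m by rewrite fsfunE; case: ifPn => // /g0.
have cP : decomposition V_ v c.
  split=> [m|]; first by rewrite cE.
  have cS : (finsupp c `<=` S)%fset.
    by apply/fsubsetP => m; rewrite mem_finsupp cE; apply: contraNT => /g0 ->.
  rewrite vE (big_fset_incl _ cS) => [|m _ /fsfun_dflt //].
  by apply: eq_bigr => m _; rewrite cE.
case: gr => _ /(_ v) [c' [_ c'U]].
by rewrite /hcomp -(c'U _ (hdecP v)) (c'U _ cP) cE.
Qed.

Lemma grading_subspace l : subspace (V_ l).
Proof. by case: gr. Qed.

Lemma hcomp_linear l : linear (hcomp l).
Proof.
move=> c u v; pose S := (finsupp (hdec u) `|` finsupp (hdec v))%fset.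
apply: (@hcomp_uniq S (fun m => c *: hcomp m u + hcomp m v)) => [m|m|].
- by case: (grading_subspace m) => _; apply; apply: hcomp_mem.
- by rewrite in_fsetU => /norP[/hcomp_supp -> /hcomp_supp ->];
    rewrite scaler0 addr0.
rewrite big_split -scaler_sumr /=.
by rewrite -!sum_hcomp_sub ?fsubsetUl ?fsubsetUr.
Qed.

Lemma hcomp_homog m v : V_ m v -> forall l, hcomp l v = if l == m then v else 0.
Proof.
move=> Vv; apply: (@hcomp_uniq [fset m]%fset) => [l|l|].
- by case: eqP => [-> //|_]; apply: subspace_zero; apply: grading_subspace.
- by rewrite in_fset1 => /negPf->.
- by rewrite big_seq_fset1 eqxx.
Qed.

Lemma hcomp_ext u v : (forall l, hcomp l u = hcomp l v) -> u = v.
Proof.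
move=> uv; pose S := (finsupp (hdec u) `|` finsupp (hdec v))%fset.
rewrite (@sum_hcomp_sub S u) ?fsubsetUl // (@sum_hcomp_sub S v) ?fsubsetUr //.
by apply: eq_bigr => l _; apply: uv.
Qed.

Lemma linear_homog_ext (W : lmodType F) (f g : V -> W) :
    linear f -> linear g -> (forall m v, V_ m v -> f v = g v) ->
  forall v, f v = g v.
Proof.
move=> fL gL fg v; rewrite (sum_hcomp v) !lin_sum //.
by apply: eq_bigr => l _; apply: fg (hcomp_mem _ _).
Qed.

Lemma hcomp_twist chi m v : hcomp m (twist chi v) = chi m *: hcomp m v.
Proof.
apply: (@hcomp_uniq (finsupp (hdec v)) (fun m => chi m *: hcomp m v)) => // l.
  by apply: subspace_scale; [apply: grading_subspace | apply: hcomp_mem].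
by move/hcomp_supp->; rewrite scaler0.
Qed.

Lemma twist_linear chi : linear (twist chi).
Proof.
move=> c u v; apply: hcomp_ext => l.
by rewrite hcomp_twist !hcomp_linear !hcomp_twist scalerDr !scalerA mulrC.
Qed.

Lemma twist_homog chi m v : V_ m v -> twist chi v = chi m *: v.
Proof.
move=> Vv; apply: hcomp_ext => l.
rewrite hcomp_twist (lin_scale (hcomp_linear l)) (hcomp_homog Vv).
by case: eqP => [->|]; rewrite ?scaler0.
Qed.

Lemma twistK chi chi' :
  (forall m, chi m * chi' m = 1) -> cancel (twist chi') (twist chi).
Proof.
move=> chiK v; apply: hcomp_ext => l.
by rewrite !hcomp_twist scalerA chiK scale1r.
Qed.
End Components.

(** * Bicharacters and color-commutative algebras *)

Section Bicharacter.
Variables (F : fieldType) (Gamma : zmodType) (eps : Gamma -> Gamma -> F).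
Hypothesis eps_bichar : bicharacter eps.

Lemma eps_neq0 l m : eps l m != 0. Proof. by case: eps_bichar. Qed.

Lemma epsV l m : eps l m = (eps m l)^-1. Proof. by case: eps_bichar. Qed.

Lemma epsC l m : eps l m * eps m l = 1.
Proof. by rewrite epsV mulVf ?eps_neq0. Qed.

Lemma epsDr l m n : eps l (m + n) = eps l m * eps l n.
Proof. by case: eps_bichar. Qed.

Lemma epsDl l m n : eps (l + m) n = eps l n * eps m n.
Proof. by rewrite epsV epsDr invfM -!epsV. Qed.

Lemma eps0r l : eps l 0 = 1.
Proof. by apply: (mulIf (eps_neq0 l 0)); rewrite -epsDr addr0 mul1r. Qed.

Lemma eps0l l : eps 0 l = 1.
Proof. by rewrite epsV eps0r invr1. Qed.

Lemma epsNl l m : eps (- l) m = (eps l m)^-1.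
Proof.
by apply: (mulIf (eps_neq0 l m)); rewrite -epsDl addNr eps0l mulVf ?eps_neq0.
Qed.

Lemma epsMnl l m n : eps (l *+ n) m = eps l m ^+ n.
Proof.
elim: n => [|n IHn]; first by rewrite mulr0n eps0l.
by rewrite mulrS epsDl IHn exprS.
Qed.

Lemma eps_diag l : eps l l != -1 -> eps l l = 1.
Proof.
move=> neq; have := epsC l l; rewrite -expr2 => /eqP.
by rewrite sqrf_eq1 (negPf neq) orbF => /eqP.
Qed.
End Bicharacter.

Section GradedAlgebra.
Variables (F : fieldType) (Gamma : zmodType) (eps : Gamma -> Gamma -> F).
Hypothesis eps_bichar : bicharacter eps.
Variables (A : algType F) (A_ : Gamma -> set A).
Hypothesis A_graded : graded_algebra A_.
Hypothesis A_comm : color_commutative_algebra eps A_.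

Local Notation hcomp := (hcomp A_).
Local Notation twist := (twist A_).

Let gr : grading A_. Proof. by case: A_graded. Qed.

Lemma homog_mul l m a b : A_ l a -> A_ m b -> A_ (l + m) (a * b).
Proof. by case: A_graded => _; apply. Qed.

Lemma mull_linear (a : A) : linear (fun x => a * x).
Proof. by move=> c u v; rewrite mulrDr scalerAr. Qed.

Lemma mulr_linear (a : A) : linear (fun x => x * a).
Proof. by move=> c u v; rewrite mulrDl scalerAl. Qed.

Lemma hcomp_mulr m b : A_ m b -> forall l a, hcomp (l + m) (a * b) = hcomp l a * b.
Proof.
move=> bm l; apply: (linear_homog_ext gr).
- exact: comp_linear (hcomp_linear gr _) (mulr_linear b).
- exact: comp_linear (mulr_linear b) (hcomp_linear gr _).
move=> n a an; rewrite (hcomp_homog gr (homog_mul an bm)) (hcomp_homog gr an).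
by rewrite (inj_eq (addIr m)); case: eqP => //; rewrite mul0r.
Qed.

(** The component of 1 in degree 0 is a right identity, hence equal to 1. *)
Lemma homog_one : A_ 0 1.
Proof.
have e0 a : a = a * hcomp 0 1.
  move: a; apply: (linear_homog_ext gr (f := id)) => //.
    exact: mulr_linear.
  move=> m x xm.
  have comp n : hcomp (m + n) x = x * hcomp n 1.
    rewrite -{1}[x]mulr1; move: (1 : A); apply: (linear_homog_ext gr).
    - exact: comp_linear (hcomp_linear gr _) (mull_linear x).
    - exact: comp_linear (mull_linear x) (hcomp_linear gr _).
    move=> p y yp; rewrite (hcomp_homog gr (homog_mul xm yp)) (hcomp_homog gr yp).
    by rewrite (inj_eq (addrI m)); case: eqP => //; rewrite mulr0.
  by rewrite -comp addr0 (hcomp_homog gr xm) eqxx.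
by have /esym := e0 1; rewrite mul1r => <-; apply: hcomp_mem gr _ _.
Qed.

Lemma twistM chi : (forall m n, chi (m + n) = chi m * chi n) ->
  forall a b, twist chi (a * b) = twist chi a * twist chi b.
Proof.
move=> chiD a b; move: a; apply: (linear_homog_ext gr).
- exact: comp_linear (twist_linear gr _) (mulr_linear b).
- exact: comp_linear (mulr_linear _) (twist_linear gr _).
move=> m a am; move: b; apply: (linear_homog_ext gr).
- exact: comp_linear (twist_linear gr _) (mull_linear _).
- exact: comp_linear (mull_linear _) (twist_linear gr _).
move=> n b bn; rewrite (twist_homog gr _ (homog_mul am bn)).
by rewrite !(twist_homog gr _ am, twist_homog gr _ bn) -scalerAl -scalerAr scalerA -chiD.
Qed.

(** Only one of the two factors has to be homogeneous: the color factors of the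
    components of the other one are absorbed in a twist. *)
Lemma color_commute m a b : A_ m a -> a * b = twist (eps m) b * a.
Proof.
move=> am; move: b; apply: (linear_homog_ext gr) => [||n b bn].
- exact: mull_linear.
- exact: comp_linear (mulr_linear _) (twist_linear gr _).
by rewrite (twist_homog gr _ bn) -scalerAl; apply: A_comm.
Qed.

Lemma color_commute_r m a b : A_ m a -> b * a = a * twist (eps (- m)) b.
Proof.
move=> am; move: b; apply: (linear_homog_ext gr) => [||n b bn].
- exact: mulr_linear.
- exact: comp_linear (mull_linear _) (twist_linear gr _).
rewrite (twist_homog gr _ bn) -scalerAr (epsNl eps_bichar) -(epsV eps_bichar).
exact: A_comm.
Qed.

Lemma color_twistK l : cancel (twist (eps (- l))) (twist (eps l)).
Proof.
apply: (twistK gr) => m.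
by rewrite (epsNl eps_bichar) mulfV // (eps_neq0 eps_bichar).
Qed.

Lemma color_twistKV l : cancel (twist (eps l)) (twist (eps (- l))).
Proof.
apply: (twistK gr) => m.
by rewrite (epsNl eps_bichar) mulVf // (eps_neq0 eps_bichar).
Qed.

Lemma color_twistM l a b : twist (eps l) (a * b) = twist (eps l) a * twist (eps l) b.
Proof. exact: twistM (epsDr eps_bichar l) a b. Qed.

Section HomogeneousMaps.
Variables (l : Gamma) (f : A -> A).
Hypothesis f_hom : hom_endo A_ l f.

Lemma hom_linear : linear f. Proof. by case: f_hom. Qed.

Lemma hom_homog m a : A_ m a -> A_ (l + m) (f a).
Proof. by case: f_hom => _; apply. Qed.

Lemma hcomp_hom m a : hcomp (l + m) (f a) = f (hcomp m a).
Proof.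
move: a; apply: (linear_homog_ext gr).
- exact: comp_linear (hcomp_linear gr _) hom_linear.
- exact: comp_linear hom_linear (hcomp_linear gr _).
move=> n a an; rewrite (hcomp_homog gr (hom_homog an)) (hcomp_homog gr an).
by rewrite (inj_eq (addrI l)); case: eqP => // _; rewrite lin_zero //; apply: hom_linear.
Qed.

Lemma twist_hom chi : (forall m n, chi (m + n) = chi m * chi n) ->
  forall a, twist chi (f a) = chi l *: f (twist chi a).
Proof.
move=> chiD; apply: (linear_homog_ext gr).
- exact: comp_linear (twist_linear gr _) hom_linear.
- exact: scale_linear (comp_linear hom_linear (twist_linear gr _)).
move=> m a am; rewrite (twist_homog gr _ am) (lin_scale hom_linear).
by rewrite (twist_homog gr _ (hom_homog am)) scalerA chiD.
Qed.

Lemma color_twist_hom m a : twist (eps m) (f a) = eps m l *: f (twist (eps m) a).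
Proof. exact: twist_hom (epsDr eps_bichar m) a. Qed.
End HomogeneousMaps.

Lemma color_leibniz l f : color_der_of eps A_ l f ->
  forall a b, f (a * b) = f a * b + twist (eps l) a * f b.
Proof.
move=> [f_hom f_der] a b; have fL := hom_linear f_hom.
move: a; apply: (linear_homog_ext gr).
- exact: comp_linear fL (mulr_linear b).
- apply: add_linear (comp_linear (mulr_linear b) fL) _.
  exact: comp_linear (mulr_linear _) (twist_linear gr _).
move=> m a am; move: b; apply: (linear_homog_ext gr).
- exact: comp_linear fL (mull_linear a).
- apply: add_linear (mull_linear _) _.
  exact: comp_linear (mull_linear _) fL.
by move=> n b bn; rewrite (f_der _ _ _ _ am bn) (twist_homog gr _ am) scalerAl.
Qed.

Lemma color_der_one l f : color_der_of eps A_ l f -> f 1 = 0.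
Proof.
move=> f_der; have := color_leibniz f_der 1 1.
rewrite (twist_homog gr _ homog_one) (eps0r eps_bichar) scale1r !mulr1 mul1r.
by move/eqP; rewrite -subr_eq subrr eq_sym => /eqP.
Qed.

Section Powers.
Variables (l : Gamma) (f : A -> A).

Lemma iter_hom n : hom_endo A_ l f -> hom_endo A_ (l *+ n) (iter n f).
Proof.
move=> f_hom; elim: n => [|n [fnL fnH]].
  by split=> // m a am; rewrite mulr0n add0r.
split=> [|m a am]; first exact: comp_linear (hom_linear f_hom) fnL.
by rewrite mulrS -addrA; apply: hom_homog f_hom _ _ _; apply: fnH.
Qed.

Hypothesis f_der : color_der_of eps A_ l f.
Hypothesis eps_ll : eps l l = 1.

(** Since [eps l l = 1], the twist by [f] commutes with [f] without any sign,
    and the powers of [f] obey the binomial formula. *)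
Lemma iter_color_leibniz n m a b : A_ m a -> iter n f (a * b) =
  \sum_(i < n.+1) ('C(n, i)%:R * eps l m ^+ (n - i)) *: (iter i f a * iter (n - i) f b).
Proof.
move=> am; have fL := hom_linear (proj1 f_der).
(* T i j is the binomial term with i factors f on a and j factors on b. *)
pose T i j := eps l m ^+ j *: (iter i f a * iter j f b).
have fT i j : f (T i j) = T i.+1 j + T i j.+1.
  rewrite (lin_scale fL) (color_leibniz f_der).
  have /(_ _ _ am) fia := hom_homog (iter_hom i (proj1 f_der)).
  rewrite (twist_homog gr _ fia) (epsDr eps_bichar) (epsV eps_bichar l (l *+ i)).
  rewrite (epsMnl eps_bichar) eps_ll expr1n invr1 mul1r scalerDr -scalerAl scalerA.
  by rewrite -exprSr.
suff -> : iter n f (a * b) = \sum_(i < n.+1) 'C(n, i)%:R *: T i (n - i)%N.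
  by apply: eq_bigr => i _; rewrite scalerA.
elim: n => [|n IHn]; first by rewrite big_ord1 bin0 scale1r /T scale1r.
rewrite iterS IHn (lin_sum fL).
under eq_bigr do rewrite (lin_scale fL) fT scalerDr.
rewrite big_split /= addrC big_ord_recl /= [RHS]big_ord_recl /= !bin0 !subn0.
rewrite -addrA; congr (_ + _).
under [RHS]eq_bigr do rewrite /bump /= binS natrD scalerDl.
rewrite big_split /=; congr (_ + _).
rewrite [RHS]big_ord_recr /= bin_small // scale0r addr0.
by apply: eq_bigr => i _; rewrite /bump /= !add1n subSS subnSK.
Qed.

(** In characteristic [p] the inner terms of the binomial formula vanish. *)
Lemma iter_color_der p : p \in [pchar F] -> color_der_of eps A_ (l *+ p) (iter p f).
Proof.
move=> pF; split=> [|m n a b am bn]; first exact: iter_hom (proj1 f_der).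
have p_pr := pcharf_prime pF; have p_gt0 := prime_gt0 p_pr.
rewrite (iter_color_leibniz p b am) -(prednK p_gt0) big_ord_recl big_ord_recr /=.
rewrite big1 => [|i _].
  rewrite /bump /= add1n prednK // add0r addrC binn bin0 subn0 subnn mul1r.
  by rewrite !mul1r expr0 scale1r (epsMnl eps_bichar).
have : (p %| 'C(p, i.+1))%N.
  apply: prime_dvd_bin => //=.
  by apply: leq_trans (_ : p.-1.+1 <= _)%N; rewrite ?ltnS ?ltn_ord ?prednK.
rewrite /bump /= add1n (prednK p_gt0) (dvdn_pcharf pF) => /eqP->.
by rewrite mul0r scale0r.
Qed.
End Powers.

Section Relations.
Variables (K : Type) (r : seq K) (deg : K -> Gamma) (f : K -> A -> A).
Hypothesis f_hom : forall k, hom_endo A_ (deg k) (f k).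

Definition relation (a : K -> A) : Prop :=
  forall x, \sum_(k <- r) a k * f k x = 0.

(** The twist is an algebra automorphism and conjugating a homogeneous map by
    it only rescales that map, so conjugation preserves relations. *)
Lemma relation_twist l a : relation a ->
  relation (fun k => eps l (deg k) *: twist (eps l) (a k)).
Proof.
move=> ra x; pose y := twist (eps (- l)) x.
have := congr1 (twist (eps l)) (ra y).
rewrite (lin_zero (twist_linear gr _)) (lin_sum (twist_linear gr _)) => E.
apply: etrans E; apply: eq_bigr => k _.
by rewrite color_twistM (color_twist_hom (f_hom k)) color_twistK -scalerAl -scalerAr.
Qed.

(** At a homogeneous point the maps [f k] shift degrees by [deg k], so each
    component of the value of the relation there involves only one component of
    every coefficient. *)
Lemma relation_hcomp l a : relation a -> relation (fun k => hcomp (l - deg k) (a k)).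
Proof.
move=> ra; apply: (linear_homog_ext gr (g := fun=> 0)) => [||m x xm].
- apply: sum_linear => k.
  exact: comp_linear (mull_linear _) (hom_linear (f_hom k)).
- exact: zero_linear.
have := congr1 (hcomp (l + m)) (ra x).
rewrite (lin_zero (hcomp_linear gr _)) (lin_sum (hcomp_linear gr _)) => E.
apply: etrans E; apply: eq_bigr => k _.
rewrite -(hcomp_mulr (hom_homog (f_hom k) xm)); congr (hcomp _ _).
by rewrite addrA subrK.
Qed.
End Relations.

(** * Color commutation in the algebra generated by constants and derivations *)

Section ColorCentralizer.
Variables (l : Gamma) (g : A -> A).
Hypothesis g_lin : linear g.

(** For [f] homogeneous of degree [m] the condition reads
    [g (f x) = eps l m *: f (g x)] ([color_centralizer_hom]).  Conjugating by
    the twist expresses it for all [f] at once; as conjugation is an algebra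
    morphism, the condition defines a subalgebra. *)
Definition color_centralizer : set (A -> A) :=
  [set f | linear f /\
     forall x, g (f x) = twist (eps l) (f (twist (eps (- l)) (g x)))].

Lemma color_centralizer_subalgebra : subalgebra color_centralizer.
Proof.
split=> [f [] //||| f f' [fL fC] [f'L f'C]]; first split.
- split=> [|x]; first exact: zero_linear.
  by rewrite !(lin_zero g_lin) (lin_zero (twist_linear gr _)).
- move=> c f f' [fL fC] [f'L f'C]; split.
    exact: add_linear (scale_linear _ fL) f'L.
  by move=> x; rewrite [LHS]g_lin fC f'C [in RHS]twist_linear.
- by split=> // x; rewrite color_twistK.
- split=> [|x /=]; first exact: comp_linear fL f'L.
  by rewrite fC f'C color_twistKV.
Qed.

Lemma color_centralizer_hom m f : hom_endo A_ m f ->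
  color_centralizer f <-> forall x, g (f x) = eps l m *: f (g x).
Proof.
move=> f_hom.
have E x : twist (eps l) (f (twist (eps (- l)) x)) = eps l m *: f x.
  by rewrite (color_twist_hom f_hom) color_twistK.
split=> [[_ fC] x|fC]; first by rewrite fC E.
by split=> [|x]; [apply: hom_linear f_hom | rewrite E].
Qed.

Lemma color_centralizer_lmul u :
  (forall x, g (u * x) = twist (eps l) u * g x) -> color_centralizer (lmul u).
Proof.
move=> uC; split=> [|x]; first exact: mull_linear.
by rewrite /lmul uC color_twistM color_twistK.
Qed.
End ColorCentralizer.

Lemma adjoin_subalgebra (U : set A) (D : set (A -> A)) :
  D `<=` [set f | linear f] -> subalgebra (adjoin U D).
Proof.
move=> DL; have lin_sub : subalgebra [set f : A -> A | linear f].
  split=> // [|f g fL gL]; last exact: comp_linear fL gL.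
  split=> [|c f g fL gL]; first exact: zero_linear.
  exact: add_linear (scale_linear c fL) gL.
have gen_lin : @lmul F A @` U `|` D `<=` [set f | linear f].
  by move=> f [[u _ <-]|/DL //]; apply: mull_linear.
have adj B f : subalgebra B -> @lmul F A @` U `|` D `<=` B -> adjoin U D f -> B f.
  by move=> sB UB; apply.
split; first by move=> f; apply: adj.
- split=> [B [[_ [B0 _] _ _] _] //|c f g fU gU B BP].
  by case: (BP.1) => _ [_ Bl] _ _; apply: Bl; [apply: fU|apply: gU].
- by move=> B [[_ _ B1 _] _].
- move=> f g fU gU B BP.
  by case: (BP.1) => _ _ _; apply; [apply: fU|apply: gU].
Qed.

Section Derivations.
Variable D : set (A -> A).
Hypothesis D_graded : graded_subspace (color_der_of eps A_) D.
Hypothesis D_comm : color_commutative_space eps A_ D.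

Local Notation D_ l := (D `&` color_der_of eps A_ l).
Local Notation F1 := (constants D).

Lemma graded_ind (W : set (A -> A)) :
  subspace W -> (forall l, D_ l `<=` W) -> D `<=` W.
Proof.
move=> W_sub DW f /(proj2 D_graded); apply: subspace_sum_of => // l g [gl gD].
exact: (DW l g).
Qed.

Lemma D_linear : D `<=` [set f | linear f].
Proof.
apply: graded_ind => [|l f [_ [[]]] //].
split=> [|c f g fL gL]; first exact: zero_linear.
exact: add_linear (scale_linear c fL) gL.
Qed.

Lemma constants_homog_ders u : (forall l f, D_ l f -> f u = 0) -> F1 u.
Proof.
move=> u0 f; apply: (@graded_ind [set f | f u = 0]) => [|l g]; last exact: (u0 l).
split=> // c g h /= gu hu.
by change (c *: g u + h u = 0); rewrite gu hu scaler0 add0r.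
Qed.

Lemma constants_hcomp m u : F1 u -> F1 (hcomp m u).
Proof.
move=> u1; apply: constants_homog_ders => l f [Df [f_hom _]].
by rewrite -(hcomp_hom f_hom) u1 // (lin_zero (hcomp_linear gr _)).
Qed.

Lemma constants_mul l f u x : F1 u -> D_ l f -> f (u * x) = twist (eps l) u * f x.
Proof. by move=> u1 [Df /color_leibniz ->]; rewrite u1 // mul0r add0r. Qed.

Lemma adjoin_ind (U : set A) (B : set (A -> A)) : subalgebra B ->
  (forall u, U u -> B (lmul u)) -> (forall l, D_ l `<=` B) -> adjoin U D `<=` B.
Proof.
move=> sB UB DB; apply: smallest_sub => // f [[u Uu <-]|]; first exact: UB.
by apply: graded_ind => //; case: sB.
Qed.

Lemma adjoin_commute_D l f : D_ l f -> adjoin F1 D `<=` color_centralizer l f.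
Proof.
move=> Df; have fL : linear f by apply: D_linear; case: Df.
apply: adjoin_ind; first exact: color_centralizer_subalgebra.
- move=> u u1; apply: color_centralizer_lmul => x; exact: constants_mul.
- move=> m g Dg; apply/(color_centralizer_hom _ _ (proj1 (proj2 Dg))) => x.
  exact: (congr1 (@^~ x) (D_comm Df Dg)).
Qed.

Lemma adjoin_commute_const m u : F1 u -> A_ m u ->
  adjoin F1 D `<=` color_centralizer m (lmul u).
Proof.
move=> u1 um; apply: adjoin_ind.
- by apply: color_centralizer_subalgebra; apply: mull_linear.
- move=> v v1; apply: color_centralizer_lmul => x.
  by rewrite /lmul mulrA (color_commute _ um) mulrA.
- move=> l f Df; apply/(color_centralizer_hom _ _ (proj1 (proj2 Df))) => x.
  rewrite /lmul (constants_mul _ u1 Df) (twist_homog gr _ um) -scalerAl scalerA.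
  by rewrite (epsC eps_bichar) scale1r.
Qed.

(** Homogeneous elements of [F1[D]] color-commute with all of [F1[D]]: commuting
    with the generators suffices, and for these one has the two previous lemmas,
    read from the other side. *)
Lemma adjoin_commute_hom m g : hom_endo A_ m g -> adjoin F1 D g ->
  adjoin F1 D `<=` color_centralizer m g.
Proof.
move=> g_hom gF; have gL := hom_linear g_hom.
(* Color commutation is symmetric, since eps l m * eps m l = 1. *)
have flip l x y : x = eps l m *: y -> y = eps m l *: x :> A.
  by move=> ->; rewrite scalerA (epsC eps_bichar) scale1r.
apply: adjoin_ind; first exact: color_centralizer_subalgebra.
- move=> u u1; apply: color_centralizer_lmul => x.
  rewrite {1}(sum_hcomp gr u) mulr_suml (lin_sum gL) mulr_suml.
  apply: eq_bigr => k _; rewrite -scalerAl; apply: flip.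
  have kF := adjoin_commute_const (constants_hcomp k u1) (hcomp_mem gr k u) gF.
  by move/(color_centralizer_hom _ _ g_hom): kF; apply.
- move=> l f Df; apply/(color_centralizer_hom _ _ (proj1 (proj2 Df))) => x.
  apply: flip; have := adjoin_commute_D Df gF.
  by move/(color_centralizer_hom _ _ g_hom); apply.
Qed.

(** * Independence over A from graded D-simplicity *)

Section IndependenceOverA.
Hypothesis A_simple : graded_D_simple A_ D.
Variables (K : choiceType) (deg : K -> Gamma) (d : K -> A -> A).
Hypothesis d_hom : forall k, hom_endo A_ (deg k) (d k).
Hypothesis d_commD : forall l f, D_ l f ->
  forall k x, f (d k x) = eps l (deg k) *: d k (f x).
Hypothesis d_free : forall c : {fsfun K -> A with 0},
  coefficients F1 [set: K] c -> lin_comb d c = 0 -> forall k, c k = 0.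

(** Applying [f] to a relation gives the differentiated relation plus a twisted
    copy of the original one, evaluated at [f x], which vanishes. *)
Lemma relation_der r a l f : D_ l f ->
  relation r d a -> relation r d (fun k => f (a k)).
Proof.
move=> Df ra x; have fL : linear f by apply: D_linear; case: Df.
have := congr1 f (ra x); rewrite (lin_zero fL) (lin_sum fL) => E.
apply: etrans E; under [RHS]eq_bigr do
  rewrite (color_leibniz (proj2 Df)) (d_commD Df) -scalerAr scalerAl.
by rewrite big_split /= (relation_twist d_hom l ra (f x)) addr0.
Qed.

(** Gradedness is [relation_hcomp], stability is [relation_der], and a right
    multiple of a homogeneous element is a left multiple of a twist of it. *)
Lemma leading_ideal r k0 (J := [set y | exists2 a, relation r d a & a k0 = y]) :
  [/\ graded_subspace A_ J, ideal J & stable_under D J].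
Proof.
have J_sub : subspace J.
  split=> [|c _ _ [a ra <-] [b rb <-]].
    by exists (fun=> 0) => // x; rewrite big1 // => k _; rewrite mul0r.
  exists (fun k => c *: a k + b k) => // x.
  under eq_bigr do rewrite mulrDl -scalerAl.
  by rewrite big_split /= -scaler_sumr ra rb scaler0 addr0.
have J_hcomp l y : J y -> J (hcomp l y).
  move=> [a ra <-]; exists (fun k => hcomp (l + deg k0 - deg k) (a k)).
    exact: relation_hcomp.
  by rewrite addrK.
have J_mull a y : J y -> J (a * y).
  move=> [b rb <-]; exists (fun k => a * b k) => // x.
  by under eq_bigr do rewrite -mulrA; rewrite -mulr_sumr rb mulr0.
split; first split=> // y Jy.
- exists (hdec A_ y); split=> [l|]; last exact: sum_hcomp gr y.
  by split; [apply: hcomp_mem gr _ _ | apply: J_hcomp].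
- split=> // a y Jy; split; first exact: J_mull.
  rewrite (sum_hcomp gr a) mulr_sumr; apply: subspace_sum => // m _.
  rewrite (color_commute_r _ (hcomp_mem gr m a)); apply: J_mull.
  by apply: subspace_sum => // l _; apply: subspace_scale; [|apply: J_hcomp].
- move=> f y Df; move: f Df y.
  apply: (@graded_ind [set f | forall y, J y -> J (f y)]) => [|l f Df].
    split=> [y _|c f g fJ gJ y Jy]; first exact: subspace_zero.
    by case: J_sub => _; apply; [apply: fJ|apply: gJ].
  by move=> _ [a ra <-]; exists (fun k => f (a k)) => //; apply: relation_der Df ra.
Qed.

(** If the coefficient at [k0] does not vanish, simplicity provides a relation
    whose coefficient at [k0] is 1.  Its image under a derivation has
    coefficient 0 there, so it is shorter and trivial by induction: the
    coefficients are constants, against independence over [F1]. *)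
Lemma free_over_algebra r a : uniq r -> relation r d a -> forall k, k \in r -> a k = 0.
Proof.
have [n] := ubnP (size r); elim: n r a => // n IHn r a r_size r_uniq ra k0 k0r.
apply: contrapT => ak0.
have [J_gr J_id J_st] := leading_ideal r k0.
have [J0|JT] := A_simple J_gr J_id J_st.
  by apply: ak0; rewrite -[_ = 0]/([set 0] (a k0)) -J0; exists a.
have [b rb b1] : [set y | exists2 a, relation r d a & a k0 = y] 1 by rewrite JT.
have bF k : k \in r -> F1 (b k).
  move=> kr; apply: constants_homog_ders => l f Df.
  have fb0 : f (b k0) = 0 by rewrite b1; apply: color_der_one (proj2 Df).
  have [->|kk0] := eqVneq k k0; first exact: fb0.
  apply: (IHn (rem k0 r) (fun k => f (b k))).
  - have r0 : (0 < size r)%N by rewrite -has_predT; apply/hasP; exists k0.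
    by rewrite size_rem // -ltnS prednK.
  - exact: rem_uniq.
  - by move=> x; have := relation_der Df rb x; rewrite (big_rem k0) //= fb0 mul0r add0r.
  - by rewrite (mem_rem_uniq k0 r_uniq) inE kk0.
have cF : coefficients F1 [set: K] (seq_coef r b).
  split=> [k|//]; rewrite seq_coefE; case: ifP => [/bF //|_].
  by move=> f Df; apply/lin_zero/D_linear.
have c0 : lin_comb d (seq_coef r b) = 0.
  by apply/funext => x; rewrite lin_comb_seq.
have := d_free cF c0 k0; rewrite seq_coefE k0r b1 => one0.
by have := oner_neq0 A; rewrite one0 eqxx.
Qed.
End IndependenceOverA.
End Derivations.

(** * Words in color-commuting derivations *)

Section Words.
Variables (disp : Order.disp_t) (I : orderType disp).
Variables (deg : I -> Gamma) (d : I -> A -> A).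
Hypothesis d_der : forall i, color_der_of eps A_ (deg i) (d i).
Hypothesis d_comm : forall i j x, d i (d j x) = eps (deg i) (deg j) *: d j (d i x).

Definition wmap (s : seq I) (x : A) : A := foldr d x s.

Definition wdeg (s : seq I) : Gamma := \sum_(i <- s) deg i.

Let d_hom i : hom_endo A_ (deg i) (d i). Proof. by case: (d_der i). Qed.

Let d_lin i : linear (d i). Proof. exact: hom_linear (d_hom i). Qed.

Lemma wmap_hom s : hom_endo A_ (wdeg s) (wmap s).
Proof.
elim: s => [|i s [sL sH]]; first by split=> // m a; rewrite /wdeg big_nil add0r.
split=> [|m a am /=]; first exact: comp_linear (d_lin i) sL.
by rewrite /wdeg big_cons -addrA; apply: hom_homog (d_hom i) _ _ _; apply: sH.
Qed.

Lemma wmap_cat s t x : wmap (s ++ t) x = wmap s (wmap t x).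
Proof. exact: foldr_cat. Qed.

(** The letter [i] is carried to the front by color commutation. *)
Lemma wmap_rem i s : i \in s -> exists c, forall x, wmap (i :: rem i s) x = c *: wmap s x.
Proof.
elim: s => // k s IHs; rewrite inE /=; have [->|ik] /= := eqVneq k i.
  by move=> _; exists 1 => x; rewrite scale1r.
move=> /IHs[c /= sE]; exists (eps (deg i) (deg k) * c) => x.
by rewrite d_comm sE (lin_scale (d_lin k)) scalerA.
Qed.

Lemma wmap_perm s t : perm_eq s t -> exists c, forall x, wmap s x = c *: wmap t x.
Proof.
elim: s t => [|i s IHs] t.
  by rewrite perm_sym => /perm_nilP->; exists 1 => x; rewrite scale1r.
move=> st; have it : i \in t by rewrite -(perm_mem st) mem_head.
have /IHs[c sE] : perm_eq s (rem i t).
  by rewrite -(perm_cons i); apply: perm_trans st (perm_to_rem it).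
have [c' tE] := wmap_rem it; exists (c * c') => x.
by rewrite /= sE (lin_scale (d_lin i)) -scalerA -tE.
Qed.

Hypothesis char_neq2 : 2%N \notin [pchar F].

(** An odd map anticommutes with itself, and 2 is invertible. *)
Lemma d_odd_square i x : Gamma_minus eps (deg i) -> d i (d i x) = 0.
Proof.
rewrite /Gamma_minus /= => odd_i; have := d_comm i i x.
rewrite odd_i scaleN1r => /eqP; rewrite -addr_eq0 -mulr2n -scaler_nat scaler_eq0.
by move: char_neq2; rewrite inE /= => /negPf-> /eqP.
Qed.

Definition bounded (s : seq I) : Prop :=
  (forall p, p \in [pchar F] -> forall i, (count_mem i s <= p.-1)%N) /\
  (forall i, Gamma_minus eps (deg i) -> (count_mem i s <= 1)%N).

Definition admissible : set (seq I) := [set s | sorted <=%O s /\ bounded s].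

Lemma bounded_le s t : (forall i, (count_mem i s <= count_mem i t)%N) ->
  bounded t -> bounded s.
Proof.
move=> st [tp t1]; split=> [p pF i|i odd_i]; apply: leq_trans (st i) _.
  exact: tp.
exact: t1.
Qed.

Lemma admissible_rem i s : admissible s -> admissible (rem i s).
Proof.
have sub := rem_subseq i s.
move=> [s_sorted s_bd]; split; first exact: subseq_sorted le_trans _ _ sub _.
by apply: bounded_le s_bd => j; apply: leq_count_subseq.
Qed.

Lemma admissible_perm_eq s t : admissible s -> admissible t -> perm_eq s t -> s = t.
Proof.
by move=> [s_sorted _] [t_sorted _]; apply: (sorted_eq le_trans le_anti).
Qed.

Hypothesis d_pow : forall p i, p \in [pchar F] -> eps (deg i) (deg i) = 1 ->
  lspan d [set: I] (iter p (d i)).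

Lemma perm_nseq_rest n i (s : seq I) : (n <= count_mem i s)%N ->
  exists2 t, perm_eq s (nseq n i ++ t) & size s = (n + size t)%N.
Proof.
move=> le_n; pose t := nseq (count_mem i s - n) i ++ filter (predC1 i) s.
have st : perm_eq s (nseq n i ++ t).
  rewrite catA -nseqD subnKC // -size_filter.
  have /all_pred1P <- := filter_all (pred1 i) s.
  by rewrite perm_sym perm_filterC.
by exists t => //; rewrite (perm_size st) size_cat size_nseq.
Qed.

Lemma wmap_nseq n i x : wmap (nseq n i) x = iter n (d i) x.
Proof. by elim: n => //= n ->. Qed.

Lemma lspan_wmapZ P c s t : (forall x, wmap s x = c *: wmap t x) ->
  lspan wmap P (wmap t) -> lspan wmap P (wmap s).
Proof. by move=> sE /(lspan_scale c); congr lspan; apply/esym/funext. Qed.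

(** The bound on the length of the resulting words is what the induction in
    [relation_top] needs: straightening a short word produces no long ones. *)
Lemma straighten s :
  lspan wmap (admissible `&` [set t | (size t <= size s)%N]) (wmap s).
Proof.
have [n] := ubnP (size s); elim: n s => // n IHn s; rewrite ltnS => s_n.
have [s_bd|s_nbd] := pselect (bounded s).
  have ss : perm_eq s (sort <=%O s) by rewrite perm_sym perm_sort.
  have [c sE] := wmap_perm ss; apply: lspan_wmapZ sE _; apply: lspan_gen.
  split; last by rewrite /= size_sort.
  split; first exact: sort_le_sorted.
  by apply: bounded_le s_bd => i; rewrite (permP ss).
have [[i [odd_i i2]]|no_odd] :=
    pselect (exists i, Gamma_minus eps (deg i) /\ (2 <= count_mem i s)%N).
  have [t st _] := perm_nseq_rest i2; have [c sE] := wmap_perm st.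
  rewrite [X in lspan _ _ X](_ : _ = fun=> 0); first exact: lspan_zero.
  apply/funext => x; rewrite sE wmap_cat wmap_nseq /=.
  by rewrite d_odd_square // scaler0.
have [p [i [pF ip]]] : exists p i, p \in [pchar F] /\ (p <= count_mem i s)%N.
  apply: contrapT => no_p; apply: s_nbd; split=> [p pF i|i odd_i].
    have p_gt0 := prime_gt0 (pcharf_prime pF).
    by rewrite -ltnS prednK // ltnNge; apply/negP => ip; apply: no_p; exists p, i.
  by rewrite leqNgt; apply/negP => i2; apply: no_odd; exists i.
have p_gt1 := prime_gt1 (pcharf_prime pF).
have even_i : eps (deg i) (deg i) = 1.
  apply: (eps_diag eps_bichar); apply/eqP => odd_i.
  by apply: no_odd; exists i; split=> //; apply: leq_trans ip.
(* A block of p letters i is a combination of single letters: as p > 1 this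
   shortens the word. *)
have [t st szs] := perm_nseq_rest ip; have [c sE] := wmap_perm st.
apply: lspan_wmapZ sE _.
have [Q [_ QE]] := lspan_list (d_pow pF even_i).
rewrite [X in lspan _ _ X](_ : _ = fun x => \sum_(q <- Q) q.1 * wmap (q.2 :: t) x).
  apply: lspan_sum => q _; apply: lspan_mull.
  have lt_s : (size (q.2 :: t) < size s)%N.
    by rewrite szs -[(_ < _)%N]/(2 + size t <= p + size t)%N leq_add2r.
  apply: lspan_sub (IHn _ (leq_trans lt_s s_n)) => u [u_adm u_sz]; split=> //=.
  by apply: leq_trans u_sz (ltnW lt_s).
by apply/funext => x; rewrite wmap_cat wmap_nseq QE.
Qed.

(** * Commuting a word with a multiplication *)

(** When [x] is moved from the right to the left of the word [s], each letter
    [j] of [s] may be spent on differentiating [x].  Bringing that [j] to the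
    front costs a color factor for every letter it passes; [kappa s j] is the
    sum of these costs over all occurrences of [j]. *)
Fixpoint kappa (s : seq I) (j : I) : F :=
  if s is i :: t then (i == j)%:R + eps (deg i) (deg j) * kappa t j else 0.

Lemma kappa_notin s j : j \notin s -> kappa s j = 0.
Proof.
elim: s => //= i s IHs; rewrite inE negb_or eq_sym => /andP[/negPf-> /IHs ->].
by rewrite mulr0 addr0.
Qed.

Lemma kappa_cons i s j :
  kappa (i :: s) j = (i == j)%:R + eps (deg i) (deg j) * kappa s j.
Proof. by []. Qed.

(** In a sorted word the occurrences of the first letter are adjacent, so
    occurrence number [n], counted from 0, costs [n] self-crossings. *)
Lemma kappa_head j s : sorted <=%O (j :: s) ->
  kappa (j :: s) j = \sum_(n < (count_mem j s).+1) eps (deg j) (deg j) ^+ n.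
Proof.
elim: s => [|k s IHs] sorted_s.
  by rewrite kappa_cons big_ord1 eqxx mulr0 addr0.
have [kj|kj] := eqVneq k j.
  move: sorted_s; rewrite kj => /andP[_ sorted_s].
  rewrite kappa_cons IHs // [RHS]big_ord_recl eqxx mulr_sumr /= eqxx.
  by congr (_ + _); apply: eq_bigr => i _; rewrite -exprS.
have j_notin : j \notin k :: s.
  rewrite inE eq_sym negb_or kj; apply: contra kj => js.
  move: sorted_s => /= /andP[le_jk].
  rewrite (path_sortedE le_trans) => /andP[/allP/(_ j js) le_kj _].
  by apply/eqP/le_anti/andP.
by rewrite kappa_cons eqxx kappa_notin // mulr0 addr0 (count_memPn j_notin) big_ord1.
Qed.

(** Up to the units collected by passing smaller letters, [kappa s j] is a
    geometric sum: for an odd [j] it has the single term 1, and for an even [j]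
    it is the multiplicity of [j], which is positive and, in characteristic
    [p], smaller than [p]. *)
Lemma kappa_neq0 s j : admissible s -> j \in s -> kappa s j != 0.
Proof.
elim: s => // i s IHs is_adm; have [is_sorted [is_p is_odd]] := is_adm.
have [ij _|ij] := eqVneq i j; last first.
  rewrite inE eq_sym (negPf ij) kappa_cons (negPf ij) add0r => js.
  rewrite mulf_neq0 ?(eps_neq0 eps_bichar) ?IHs //.
  by have := admissible_rem i is_adm; rewrite /= eqxx.
move: is_adm is_sorted is_p is_odd; rewrite {i}ij => _ is_sorted is_p is_odd.
have jE : count_mem j (j :: s) = (count_mem j s).+1 by rewrite /= eqxx.
rewrite kappa_head //; have [odd_j|even_j] := pselect (Gamma_minus eps (deg j)).
  have := is_odd _ odd_j; rewrite jE ltnS leqn0 => /eqP->.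
  by rewrite big_ord1 oner_neq0.
under eq_bigr do rewrite (eps_diag eps_bichar (introN eqP even_j)) expr1n.
rewrite sumr_const card_ord; apply/negP => n0.
have [//|p pF] := natf0_pchar _ n0.
have p_gt0 := prime_gt0 (pcharf_prime pF).
have := is_p p pF j; rewrite jE -ltnS prednK // ltnNge dvdn_leq //.
by rewrite (dvdn_pcharf pF).
Qed.

Lemma rem_head (i : I) (s : seq I) : sorted <=%O (i :: s) -> i \in s -> s = i :: rem i s.
Proof.
case: s => // k s is_sorted; rewrite inE /=; have [-> //|ki /= i_s] := eqVneq k i.
move: is_sorted => /= /andP[le_ik].
rewrite (path_sortedE le_trans) => /andP[/allP/(_ i i_s) le_ki _].
by move: ki; rewrite (le_anti (introT andP (conj le_ki le_ik))) eqxx.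
Qed.

Section Expansion.
Variables (m : Gamma) (x : A).
Hypothesis x_hom : A_ m x.
Variable U : seq I.
Hypothesis U_uniq : uniq U.

(** What is left of the commutator of a word with the multiplication by [x]
    after removing the terms in which [x] is differentiated exactly once. *)
Definition remainder (s : seq I) (y : A) : A :=
  wmap s (x * y) - eps (wdeg s) m *: (x * wmap s y)
  - \sum_(j <- U) (kappa s j * eps (wdeg s - deg j) m) *: (d j x * wmap (rem j s) y).

(** Two letters shorter: words this short cannot interfere with a word that
    lost a single letter. *)
Definition shorter2 (n : nat) : set (seq I) := [set t | ((size t).+2 <= n)%N].

Lemma lspan_d i (P P' : set (seq I)) f : P `<=` P' ->
  (forall t, P t -> P' (i :: t)) -> lspan wmap P f -> lspan wmap P' (fun y => d i (f y)).
Proof.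
move=> PP' dP fP; apply: proj2 (_ : lspan wmap P' f /\ _).
apply: (lspan_ind (M := [set f | lspan wmap P' f /\
    lspan wmap P' (fun y => d i (f y))])) fP.
  split=> [|g h [gP dg] [hP dh]|a g _ [gP dg]].
  - split; first exact: lspan_zero.
    by have := @lspan_zero _ _ _ wmap P'; congr lspan;
      apply/funext => y; rewrite (lin_zero (d_lin i)).
  - split; first exact: lspan_add.
    have := lspan_add dg dh; congr lspan; apply/funext => y.
    by rewrite -(lin_add (d_lin i)).
  - split; first exact: lspan_mull.
    have := lspan_add (lspan_mull (d i a) gP) (lspan_mull (twist (eps (deg i)) a) dg).
    by congr lspan; apply/funext => y; rewrite /lmul /= (color_leibniz (d_der i)).
move=> t tP; split; first by apply: lspan_gen; apply: PP'.
exact: (@lspan_gen _ _ _ wmap P' (i :: t) (dP t tP)).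
Qed.

Lemma wdeg_rem j s : j \in s -> wdeg (rem j s) = wdeg s - deg j.
Proof. by move=> js; rewrite [wdeg s]/wdeg (big_rem j) //= addrAC subrr add0r. Qed.

Lemma leading_term_shorter s j c a : lspan wmap (shorter2 (size s).+1)
  (fun y => (kappa s j * c) *: (a * wmap (rem j s) y)).
Proof.
have [js|js] := boolP (j \in s).
  apply: lspan_scale; apply: lspan_mull; apply: lspan_gen.
  by rewrite /shorter2 /= size_rem //; case: (s) js.
rewrite [X in lspan _ _ X](_ : _ = fun=> 0); first exact: lspan_zero.
by apply/funext => y; rewrite kappa_notin // mul0r scale0r.
Qed.

(** Adding a letter [i] in front, the Leibniz rule either moves [i] past the
    terms found so far, or spends it on a scalar: on [x] itself this gives the
    new first-order term, on an already differentiated [x] a term that has lost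
    two letters. *)
Lemma remainder_shorter s : sorted <=%O s -> {subset s <= U} ->
  lspan wmap (shorter2 (size s)) (remainder s).
Proof.
elim: s => [|i s IHs] is_sorted sU.
  have := @lspan_zero _ _ _ wmap (shorter2 0); congr lspan; apply/funext => y.
  rewrite /remainder /wdeg big_nil (eps0l eps_bichar) scale1r subrr sub0r.
  by rewrite big1 ?oppr0 // => j _; rewrite mul0r scale0r.
have s_sorted : sorted <=%O s by apply: path_sorted is_sorted.
have {IHs} := IHs s_sorted (fun k ks => sU k (mem_behead (s := i :: s) ks)).
move/(@lspan_d i _ (shorter2 (size s).+1)).
move=> /(_ (fun t => @leqW _ _)) /(_ (fun t tP => tP)).
set R := (fun y => _) => RP.
pose R' y := \sum_(j <- U)
  (kappa s j * eps (wdeg s - deg j) m) *: (d i (d j x) * wmap (rem j s) y).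
have R'P : lspan wmap (shorter2 (size s).+1) R'.
  by apply: lspan_sum => j _; apply: leading_term_shorter.
have := lspan_add RP R'P; congr lspan; apply/funext => y; rewrite /R /R' /remainder.
rewrite !(lin_add (d_lin i)) !(lin_opp (d_lin i)) (lin_scale (d_lin i)).
rewrite (lin_sum (d_lin i)) (color_leibniz (d_der i)) (twist_homog gr _ x_hom).
have -> : \sum_(j <- U) d i ((kappa s j * eps (wdeg s - deg j) m) *:
      (d j x * wmap (rem j s) y)) =
    \sum_(j <- U) (kappa s j * eps (wdeg s - deg j) m * eps (deg i) (deg j + m)) *:
      (d j x * d i (wmap (rem j s) y)) + R' y.
  rewrite -big_split /=; apply: eq_bigr => j _.
  rewrite (lin_scale (d_lin i)) (color_leibniz (d_der i)).
  rewrite (twist_homog gr _ (hom_homog (d_hom j) x_hom)).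
  by rewrite scalerDr -scalerAl scalerA addrC.
have -> : \sum_(j <- U) (kappa (i :: s) j * eps (wdeg (i :: s) - deg j) m) *:
      (d j x * wmap (rem j (i :: s)) y) =
    eps (wdeg s) m *: (d i x * wmap s y) +
    \sum_(j <- U) (kappa s j * eps (wdeg s - deg j) m * eps (deg i) (deg j + m)) *:
      (d j x * d i (wmap (rem j s) y)).
  under eq_bigr do rewrite kappa_cons mulrDl scalerDl.
  rewrite big_split /=; congr (_ + _).
    rewrite (bigD1_seq i) ?sU ?mem_head //= !eqxx mul1r big1 => [|j ji]; last first.
      by rewrite eq_sym (negPf ji) mul0r scale0r.
    by rewrite addr0 /wdeg big_cons addrAC subrr add0r.
  apply: eq_bigr => j _; have [js|js] := boolP (j \in s); last first.
    by rewrite kappa_notin // mulr0 !mul0r !scale0r.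
  congr (_ *: (_ * _)).
    rewrite [wdeg (i :: s)]/wdeg big_cons -addrA -/(wdeg s).
    rewrite (epsDl eps_bichar (deg i)) (epsDr eps_bichar).
    by rewrite [_ * kappa s j]mulrC [eps _ m * _]mulrC mulrACA.
  have [ij|//] := eqVneq i j.
  (* i is minimal and occurs in s, so it is also the first letter of s. *)
  by rewrite -ij {1}(rem_head is_sorted) ?ij.
rewrite opprD addrA subrK scalerDr -scalerAl scalerA.
rewrite /wdeg big_cons (epsDl eps_bichar) [eps (deg i) m * _]mulrC.
by rewrite [_ *: _ + _ in LHS]addrC !opprD !addrA.
Qed.

Lemma commutator_shorter s : sorted <=%O s -> {subset s <= U} ->
  lspan wmap (shorter2 (size s).+1)
    (fun y => wmap s (x * y) - eps (wdeg s) m *: (x * wmap s y)).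
Proof.
move=> s_sorted sU; have := remainder_shorter s_sorted sU.
move/(lspan_sub (fun t => @leqW (size t).+2 (size s))) => remP.
have sumP : lspan wmap (shorter2 (size s).+1) (fun y => \sum_(j <- U)
    (kappa s j * eps (wdeg s - deg j) m) *: (d j x * wmap (rem j s) y)).
  by apply: lspan_sum => j _; apply: leading_term_shorter.
by have := lspan_add remP sumP; congr lspan; apply/funext => y; rewrite subrK.
Qed.
End Expansion.

(** * Independence of the admissible words *)

Hypothesis d_free : lfree d [set: I].

Lemma wmap_one s : s != [::] -> wmap s 1 = 0.
Proof.
elim: s => // i s IHs _ /=; have [->|/IHs ->] := eqVneq s [::].
  exact: color_der_one (d_der i).
exact: lin_zero (d_lin i).
Qed.

Lemma straighten_shorter2 n :
  lspan wmap (shorter2 n) `<=` lspan wmap (admissible `&` shorter2 n).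
Proof.
apply: lspan_trans => s s_n; move: (@straighten s).
by apply: lspan_sub => t [t_adm t_s]; split=> //; apply: leq_trans s_n; rewrite !ltnS.
Qed.

Section InductionStep.
Variable n : nat.
Hypothesis IHn : lfree wmap (admissible `&` [set s | (size s < n)%N]).
Variables (r : seq (seq I)) (a : seq I -> A).
Hypothesis r_uniq : uniq r.
Hypothesis r_adm : forall s, s \in r -> admissible s.
Hypothesis r_size : forall s, s \in r -> (size s <= n)%N.
Hypothesis ra : relation r wmap a.

Let U := undup (flatten r).

Let sU s : s \in r -> {subset s <= U}.
Proof. by move=> sr j js; rewrite mem_undup; apply/flattenP; exists s. Qed.

(** The coefficient of the word [rem j s] in the first-order part of the
    commutator of [s] with [x]. *)
Let cof m x s j : A := (kappa s j * eps (wdeg s - deg j) m) *: d j x.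

(** The color factors [eps (wdeg s) m] turn [x * a s] into the conjugated
    relation, so both halves of the commutators sum to zero. *)
Lemma relation_commutator m x : A_ m x -> forall y,
  \sum_(s <- r) a s * (wmap s (x * y) - eps (wdeg s) m *: (x * wmap s y)) = 0.
Proof.
move=> xm y; under eq_bigr do rewrite mulrBr.
rewrite sumrB (ra (x * y)) sub0r; apply/eqP; rewrite oppr_eq0; apply/eqP.
have := congr1 (fun z => x * z) (relation_twist wmap_hom (- m) ra y).
rewrite /= mulr0 mulr_sumr => E; apply: etrans E; apply: eq_bigr => s _.
rewrite (epsNl eps_bichar) -(epsV eps_bichar) -scalerAl -!scalerAr !mulrA.
by rewrite (color_commute_r _ xm).
Qed.

(** The commutators of the words of maximal length [n] start at length
    [n.-1]; everything else, including the full commutators of the shorter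
    words, is in the span of admissible words of length at most [n - 2].  The
    sum is thus the total coefficient of [t] in a relation between words of
    length less than [n]. *)
Lemma relation_top m x t : A_ m x -> size t = n.-1 -> (0 < n)%N ->
  \sum_(s <- r | size s == n) \sum_(j <- U | (j \in s) && (rem j s == t))
    a s * cof m x s j = 0.
Proof.
move=> xm t_size n_gt0.
pose f y := \sum_(s <- r) a s * (if size s == n then remainder m x U s y
  else wmap s (x * y) - eps (wdeg s) m *: (x * wmap s y)).
have U_uniq : uniq U by apply: undup_uniq.
have fP : lspan wmap (admissible `&` shorter2 n) f.
  apply: straighten_shorter2; apply: lspan_sum => s sr; apply: lspan_mull.
  have [s_sorted _] := r_adm sr.
  case: eqP => [<-|/eqP s_n].
    by apply: (remainder_shorter xm) => //; apply: sU.
  have s_lt : (size s < n)%N by rewrite ltn_neqAle s_n r_size.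
  have := commutator_shorter xm U_uniq s_sorted (@sU s sr).
  by apply: lspan_sub => u u_s; apply: leq_trans u_s s_lt.
have [Q [QP QE]] := lspan_list fP.
pose H := [seq (a s * cof m x s j, rem j s) |
  s <- [seq s <- r | size s == n], j <- [seq j <- U | j \in s]].
have HQ0 y : \sum_(q <- H ++ Q) q.1 * wmap q.2 y = 0.
  rewrite big_cat -QE /= big_allpairs_dep /= big_filter.
  rewrite -[RHS](relation_commutator xm y) /f big_mkcond -big_split /=.
  apply: eq_bigr => s _; case: eqP => _; last by rewrite add0r.
  rewrite /remainder mulrBr addrC -[RHS](subrK (a s * \sum_(j <- U)
    (kappa s j * eps (wdeg s - deg j) m) *: (d j x * wmap (rem j s) y))).
  congr (_ + _); rewrite big_filter big_mkcond mulr_sumr; apply: eq_bigr => j _.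
  case: ifPn => js; first by rewrite /cof -mulrA -scalerAl.
  by rewrite kappa_notin // mul0r scale0r mulr0.
have HQP q : q \in H ++ Q -> (admissible `&` [set s | (size s < n)%N]) q.2.
  rewrite mem_cat => /orP[/allpairsPdep[s [j [+ + ->]]]|/QP[q_adm q_n]] /=.
    rewrite !mem_filter => /andP[/eqP s_n sr] /andP[js _].
    split; first exact/admissible_rem/r_adm.
    by rewrite /= size_rem // s_n prednK.
  by split=> //; apply: leq_trans q_n.
have := lfree_collect IHn HQP HQ0 t.
rewrite big_cat /= [X in _ + X]big1_seq ?addr0 => [|q /andP[/eqP qt /QP[_]]]; last first.
  by rewrite /shorter2 /= qt t_size prednK // ltnn.
rewrite big_mkcond big_allpairs_dep /= big_filter => E; apply: etrans E.
by apply: eq_bigr => s _; rewrite big_filter -big_mkcondr.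
Qed.
(** For [t] equal to [s0] without [j0], [relation_top] is, as [x] varies, an
    [A]-relation between the letters.  Its coefficient at [j0] is a nonzero
    multiple of [a s0] alone, because a sorted word is determined by [j0] and
    [t]. *)
Lemma relation_top_zero s0 : s0 \in r -> size s0 = n -> a s0 = 0.
Proof.
move=> s0r s0n; have [s00|] := eqVneq s0 [::].
  (* All words but the empty one kill 1. *)
  have := ra 1; rewrite (bigD1_seq s0) //= s00 big1 => [|s /wmap_one ->].
    by rewrite addr0 mulr1.
  exact: mulr0.
case: s0 s0r s0n => // j0 s1; set s0 := j0 :: s1 => s0r s0n _.
have js0 : j0 \in s0 by apply: mem_head.
pose t := rem j0 s0.
have n_gt0 : (0 < n)%N by rewrite -s0n.
have t_size : size t = n.-1 by rewrite size_rem // s0n.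
pose b j := \sum_(s <- r | [&& size s == n, j \in s & rem j s == t]) kappa s j *: a s.
have b_rel : relation U d b.
  apply: (linear_homog_ext gr (g := fun=> 0)) => [||m x xm].
  - apply: sum_linear => j; exact: comp_linear (mull_linear _) (d_lin j).
  - exact: zero_linear.
  have := relation_top xm t_size n_gt0.
  have -> : \sum_(s <- r | size s == n) \sum_(j <- U | (j \in s) && (rem j s == t))
      a s * cof m x s j = eps (wdeg t) m *: \sum_(j <- U) b j * d j x.
    rewrite scaler_sumr [RHS](eq_bigr (fun j => \sum_(s <- r |
        [&& size s == n, j \in s & rem j s == t]) a s * cof m x s j)) => [|j _].
      rewrite [RHS](exchange_big_dep (fun s => size s == n)) => [|j s _ /and3P[] //].
      by apply: eq_bigr => s s_n; apply: eq_bigl => j; rewrite s_n.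
    rewrite /b mulr_suml scaler_sumr; apply: eq_bigr => s /and3P[_ js /eqP st].
    rewrite /cof -st wdeg_rem // -scalerAl -scalerAr !scalerA.
    by rewrite mulrC.
  by move/eqP; rewrite scaler_eq0 (negPf (eps_neq0 eps_bichar _ _)) => /eqP.
have := d_free (undup_uniq _) (fun _ _ => Logic.I) b_rel (sU s0r js0).
rewrite /b big_seq_cond (eq_bigl (pred1 s0)) => [|s]; last first.
  apply/idP/eqP => [/and4P[sr _ js /eqP st]|->].
    have perm_ss0 : perm_eq s s0.
      by apply: perm_trans (perm_to_rem js) _; rewrite st perm_sym perm_to_rem.
    exact: admissible_perm_eq (r_adm sr) (r_adm s0r) perm_ss0.
  by rewrite s0r s0n js0 !eqxx.
rewrite -big_filter filter_pred1_uniq // big_seq1 => /eqP.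
by rewrite scaler_eq0 (negPf (kappa_neq0 (r_adm s0r) js0)) => /eqP.
Qed.
End InductionStep.

Lemma wmap_free : lfree wmap admissible.
Proof.
suff free_lt n : lfree wmap (admissible `&` [set s | (size s < n)%N]).
  move=> r a r_uniq r_adm ra.
  apply: (free_lt (\max_(s <- r) size s).+1 r a) => // s sr; split; first exact: r_adm.
  by rewrite /= ltnS leq_bigmax_seq.
elim: n => [|n IHn] r a r_uniq rP ra; first by move=> s /rP[].
have r_adm s : s \in r -> admissible s by case/rP.
have r_size s : s \in r -> (size s <= n)%N by case/rP.
have top := relation_top_zero IHn r_uniq r_adm r_size ra.
pose r' := [seq s <- r | (size s < n)%N].
have r'0 : forall s, s \in r' -> a s = 0.
  apply: (IHn r' a) => [|s|x]; first exact: filter_uniq.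
    by rewrite mem_filter => /andP[s_n /r_adm].
  rewrite big_filter -[RHS](ra x) big_mkcond [LHS]big_seq [RHS]big_seq.
  apply: eq_bigr => s sr; case: ifPn => // s_n.
  rewrite top ?mul0r //; apply/eqP.
  by rewrite eqn_leq r_size // leqNgt.
move=> s sr; have [s_n|s_n] := eqVneq (size s) n; first exact: top.
by apply: r'0; rewrite mem_filter sr ltn_neqAle s_n r_size.
Qed.

(** * The algebra spanned by the words *)

Lemma lspan_subalgebra : subalgebra (lspan wmap [set: seq I]).
Proof.
set M := lspan wmap [set: seq I].
have wM s : M (wmap s) by apply: lspan_gen.
split.
- apply: lspan_ind => [|s _]; last exact: hom_linear (wmap_hom s).
  split=> [|f g fL gL|a f _ fL]; first exact: zero_linear.
    exact: add_linear.
  exact: comp_linear (mull_linear a) fL.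
- split=> [|c f g fM gM]; first exact: lspan_zero.
  exact: lspan_add (lspan_scale c fM) gM.
- exact: (wM [::]).
- move=> f g fM gM; move: f fM; apply: lspan_ind => [|s _].
    split=> [|f h fM hM|a f _ fM]; first exact: lspan_zero.
      exact: lspan_add.
    exact: lspan_mull.
  elim: s => // i s IHs.
  exact: (lspan_d (P := [set: seq I])).
Qed.

Lemma lspan_admissible : lspan wmap admissible = lspan wmap [set: seq I].
Proof.
apply/seteqP; split; first exact: lspan_sub.
by apply: lspan_trans => s _; move: (@straighten s); apply: lspan_sub => t [].
Qed.

(** * From words to exponent families *)
Local Notation exponent := {fsfun I -> nat with 0%N}.

Definition word (alpha : exponent) : seq I :=
  flatten [seq nseq (alpha i) i | i <- sort <=%O (finsupp alpha)].

Definition exponent_of (s : seq I) : exponent :=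
  [fsfun i in [fset i in s]%fset => count_mem i s].

Lemma exponent_ofE s i : exponent_of s i = count_mem i s.
Proof. by rewrite fsfunE in_fset; case: ifPn => // /count_memPn->. Qed.

Lemma monomialE alpha : monomial d alpha = wmap (word alpha).
Proof.
rewrite /monomial /word; elim: (sort _ _) => [|i r IHr]; first by rewrite big_nil.
rewrite big_cons IHr /=; apply/funext => x.
by rewrite wmap_cat wmap_nseq.
Qed.

Lemma count_word alpha i : count_mem i (word alpha) = alpha i.
Proof.
have aux r : uniq r ->
    count_mem i (flatten [seq nseq (alpha k) k | k <- r]) =
      if i \in r then alpha i else 0%N.
  elim: r => //= k r IHr /andP[kr /IHr E].
  rewrite count_cat E count_nseq /= inE eq_sym; case: eqVneq => [->|_] /=.
    by rewrite (negPf kr) mul1n addn0.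
  by rewrite mul0n add0n.
rewrite aux ?sort_uniq ?fset_uniq // mem_sort; case: ifPn => //.
by move/fsfun_dflt.
Qed.

Lemma wordK : cancel word exponent_of.
Proof. by move=> alpha; apply/fsfunP => i; rewrite exponent_ofE count_word. Qed.

Lemma word_sorted alpha : sorted <=%O (word alpha).
Proof.
have : sorted <=%O (sort <=%O (finsupp alpha)) by apply: sort_le_sorted.
rewrite /word !(sorted_pairwise le_trans); elim: (sort _ _) => //= i r IHr.
case/andP=> ir /IHr r_sorted; rewrite pairwise_cat r_sorted andbT; apply/andP; split.
  apply/allrelP => j k; rewrite mem_nseq => /andP[_ /eqP->] /flattenP[_ /mapP[l lr ->]].
  by rewrite mem_nseq => /andP[_ /eqP->]; apply: (allP ir).
by elim: (alpha i) => //= n ->; rewrite andbT all_nseq lexx orbT.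
Qed.

Lemma admissible_word alpha : exponents eps deg alpha <-> admissible (word alpha).
Proof.
split=> [[alpha_p alpha_odd]|[_ [word_p word_odd]]].
  split; first exact: word_sorted.
  by split=> [p pF i|i odd_i]; rewrite count_word; [apply: alpha_p|apply: alpha_odd].
by split=> [p pF i|i odd_i]; rewrite -count_word; [apply: word_p|apply: word_odd].
Qed.

Lemma exponent_ofK s : sorted <=%O s -> word (exponent_of s) = s.
Proof.
move=> s_sorted; apply: (sorted_eq le_trans le_anti) => //; first exact: word_sorted.
by apply/allP => i _; rewrite /= count_word exponent_ofE.
Qed.

Lemma lspan_monomial : lspan (monomial d) (exponents eps deg) = lspan wmap [set: seq I].
Proof.
rewrite -lspan_admissible; apply/seteqP; split.
  apply: lspan_ind; first exact: lspan_module.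
  by move=> alpha /admissible_word; rewrite monomialE; apply: lspan_gen.
apply: lspan_ind; first exact: lspan_module.
move=> s s_adm; have sE := exponent_ofK (proj1 s_adm).
rewrite -sE -monomialE; apply: lspan_gen.
by apply/admissible_word; rewrite sE.
Qed.

Lemma monomial_free : lfree (monomial d) (exponents eps deg).
Proof.
move=> r a r_uniq r_exp ra alpha alpha_r; rewrite -[alpha]wordK.
apply: (wmap_free (r := [seq word beta | beta <- r]) (a := a \o exponent_of)).
- by rewrite map_inj_uniq //; apply: can_inj wordK.
- by move=> _ /mapP[beta /r_exp beta_exp ->]; apply/admissible_word.
- move=> x; rewrite -[RHS](ra x) big_map; apply: eq_bigr => beta _.
  by rewrite /= wordK monomialE.
- exact: map_f.
Qed.
End Words.
End GradedAlgebra.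

(** * The basis of A[D] *)

Lemma sum_of_homog (F : fieldType) (Gamma : zmodType) (V : lmodType F)
    (V_ : Gamma -> set V) l v : (forall m, V_ m 0) -> V_ l v -> sum_of V_ v.
Proof.
move=> V0 Vv; pose c : {fsfun Gamma -> V with 0} := [fsfun m in [fset l]%fset => v].
have cE m : c m = if m == l then v else 0 by rewrite fsfunE in_fset1.
exists c; split=> [m|]; first by rewrite cE; case: eqP => [->|].
have sub : (finsupp c `<=` [fset l])%fset.
  apply/fsubsetP => m; rewrite mem_finsupp cE in_fset1.
  by case: (m =P l) => // _; rewrite eqxx.
rewrite (big_fset_incl _ sub) => [|m _ /fsfun_dflt //].
by rewrite big_seq_fset1 cE eqxx.
Qed.

Lemma adjoin_mono (F : fieldType) (A : algType F) (U U' : set A) (D : set (A -> A)) :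
  U `<=` U' -> adjoin U D `<=` adjoin U' D.
Proof.
move=> UU' f fU B [B_sub UDB]; apply: fU; split=> // g [[u Uu <-]|Dg]; apply: UDB.
  by left; exists u => //; apply: UU'.
by right.
Qed.

Theorem theorem3p2
  (F : fieldType) (char_neq2 : 2%N \notin [pchar F])
  (Gamma : zmodType) (eps : Gamma -> Gamma -> F) (eps_bichar : bicharacter eps)
  (A : algType F) (A_ : Gamma -> set A)
  (A_graded : graded_algebra A_)
  (A_comm : color_commutative_algebra eps A_)
  (D : set (A -> A))
  (D_graded : graded_subspace (color_der_of eps A_) D)
  (D_neq0 : exists2 f, D f & f != 0)
  (D_comm : color_commutative_space eps A_ D)
  (A_simple : graded_D_simple A_ D)
  (disp : Order.disp_t) (I : orderType disp)
  (d : I -> A -> A) (deg : I -> Gamma)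
  (d_hom : forall i, color_der_of eps A_ (deg i) (d i))
  (d_basis :
     module_basis (constants D) (der_closure eps A_ D) [set: I] d) :
  [/\ left_module [set: A] (adjoin [set: A] D),
      module_basis [set: A] (adjoin [set: A] D) (exponents eps deg) (monomial d)
    & forall alpha, exponents eps deg alpha ->
        exists l, hom_endo A_ l (monomial d alpha)].
Proof.
have [d_clos d_span d_free] := d_basis.
have DL : D `<=` [set f | linear f] by apply: D_linear D_graded.
have d_adj i : adjoin (constants D) D (d i) by case: (d_clos i Logic.I).
have d_endo i : hom_endo A_ (deg i) (d i) by case: (d_hom i).
have dd_comm i j x : d i (d j x) = eps (deg i) (deg j) *: d j (d i x).
  have := adjoin_commute_hom eps_bichar A_graded A_comm D_graded D_comm
    (d_endo i) (d_adj i) (d_adj j).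
  by move/(color_centralizer_hom eps_bichar A_graded (deg i) (d i) (d_endo j)).
have d_commD l f : (D `&` color_der_of eps A_ l) f ->
    forall i x, f (d i x) = eps l (deg i) *: d i (f x).
  move=> Df i; have := adjoin_commute_D eps_bichar A_graded D_graded D_comm Df (d_adj i).
  by move/(color_centralizer_hom eps_bichar A_graded l f (d_endo i)).
have dd_free : lfree d [set: I].
  move=> r a r_uniq _.
  exact: (free_over_algebra eps_bichar A_graded A_comm D_graded A_simple
    d_endo d_commD d_free).
have D_ders : D `<=` color_der eps A_.
  by move=> f /(proj2 D_graded) [c [cP fE]]; exists c; split=> // l; case: (cP l).
have D_adj U : D `<=` adjoin U D by move=> f Df; apply: sub_gen_smallest; right.
have clos_lspan f : der_closure eps A_ D f -> lspan d [set: I] f.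
  by move=> /d_span[c [_ cT] ->]; apply: lin_comb_lspan.
have der0 l : color_der_of eps A_ l 0.
  split=> [|m n a b _ _]; last by rewrite mul0r mulr0 scaler0 addr0.
  split=> [|m a _]; first exact: zero_linear.
  by apply: subspace_zero; apply: grading_subspace; case: A_graded.
have d_pow p i : p \in [pchar F] -> eps (deg i) (deg i) = 1 ->
    lspan d [set: I] (iter p (d i)).
  move=> pF even_i; apply: clos_lspan; split.
    exact: sum_of_homog der0 (iter_color_der eps_bichar A_graded (d_hom i) even_i pF).
  have [_ _ id_adj comp_adj] := adjoin_subalgebra (constants D) DL.
  by elim: (p) => // n IHn; apply: comp_adj (d_adj i) IHn.
have [adjL adj_sub adj_id adj_comp] := adjoin_subalgebra [set: A] DL.
have adjE : adjoin [set: A] D = lspan (monomial d) (exponents eps deg).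
  rewrite (lspan_monomial eps_bichar d_hom dd_comm char_neq2 d_pow).
  apply/seteqP; split.
    apply: (smallest_sub (lspan_subalgebra A_graded d_hom)).
    move=> f [[a _ <-]|Df].
      exact: (lspan_mull a (@lspan_gen _ _ _ (wmap d) [set: seq I] [::] Logic.I)).
    have : lspan d [set: I] f by apply: clos_lspan; split; [apply: D_ders|apply: D_adj].
    apply: lspan_ind; first exact: lspan_module.
    by move=> i _; apply: (@lspan_gen _ _ _ (wmap d) _ [:: i]).
  apply: lspan_ind => [|s _].
    split=> [|f g|a f _]; first exact: subspace_zero.
      exact: subspace_add.
    by apply: adj_comp; apply: sub_gen_smallest; left; exists a.
  elim: s => [|i s IHs]; first exact: adj_id.
  by apply: adj_comp IHs; apply: adjoin_mono (d_adj i).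
split.
- rewrite adjE; exact: lspan_module.
- split=> [alpha alpha_exp|f|c c_coef].
  + by rewrite adjE; apply: lspan_gen.
  + by rewrite adjE; apply: lspan_lin_comb.
  + apply: lfree_lin_comb c_coef.
    exact: (monomial_free eps_bichar A_graded A_comm d_hom dd_comm char_neq2 d_pow dd_free).
- move=> alpha _; exists (wdeg deg (word alpha)); rewrite monomialE.
  exact: wmap_hom d_hom _.
Qed.
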